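(* Let $n,M\ge1$ be integers, let $X$ be an $n\times M$ real matrix, and let $c_0\in\{1,3\}$. Assume that the Gram matrix $\Psi=\frac1nX^TX$ satisfies $\Psi_{j,j}=1$ for all $1\le j\le M$ and $$\max_{i\ne j}|\Psi_{i,j}|\le\frac{1}{\alpha(1+2c_0)s}$$ for some integer $s\ge1$ and some constant $\alpha>1$. Let $Y,W\in\mathbb{R}^n$. If $\theta^1,\theta^2\in\mathbb{R}^M$ satisfy $Y=X\theta^1+W$, $Y=X\theta^2+W$, $M(\theta^1)\le s$ and $M(\theta^2)\le s$, then $\theta^1=\theta^2$. That is, the vector $\theta^*$ satisfying $Y=X\theta^*+W$ and $M(\theta^* )\le s$ is unique.
   Context: For $\theta\in\mathbb{R}^M$, $M(\theta)$ denotes the number of non-zero coordinates of $\theta$. $M$ may exceed $n$. *)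

(* Defs.v *)
From mathcomp Require Import all_boot all_order all_algebra.
From mathcomp Require Import reals.

Set Implicit Arguments.
Unset Strict Implicit.
Unset Printing Implicit Defensive.

Import Order.TTheory GRing.Theory Num.Theory.
Local Open Scope ring_scope.

Definition gram (R : realType) (n M : nat) (X : 'M[R]_(n, M)) : 'M[R]_M :=
  n%:R^-1 *: (X^T *m X).

(* M(theta) in the mathematical text *)
Definition nnz (R : realType) (M : nat) (theta : 'cV[R]_M) : nat :=
  #|[set j : 'I_M | theta j 0 != 0]|.

(* The default 0 is immaterial unless M <= 1 (no off-diagonal entry), since
   the entries are absolute values; in that case the maximum is 0. *)
Definition max_offdiag (R : realType) (M : nat) (Psi : 'M[R]_M) : R :=
  \big[Num.max/0]_(p : 'I_M * 'I_M | p.1 != p.2) `|Psi p.1 p.2|.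

(* Main.v *)
Require Import Defs.
From mathcomp Require Import all_boot all_order all_algebra.
From mathcomp Require Import reals lra.

Import Order.TTheory GRing.Theory Num.Theory.
Local Open Scope ring_scope.

(** The difference d of two solutions satisfies Psi d = 0 and has at most 2s
    non-zero entries. With mu the largest off-diagonal entry of Psi, row k of
    Psi d = 0 gives |d_k| <= mu |d|_1 because the diagonal is 1; summing over
    the support of d, |d|_1 <= 2 s mu |d|_1, and 2 s mu < 1 forces d = 0. *)

Lemma max_offdiag_ge0 (R : realType) (M : nat) (Psi : 'M[R]_M) :
  0 <= max_offdiag Psi.
Proof.
by apply: (big_ind (fun x => 0 <= x)) => // x y x0 y0; rewrite le_max x0.
Qed.

Lemma le_max_offdiag (R : realType) (M : nat) (Psi : 'M[R]_M) (i j : 'I_M) :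
  i != j -> `|Psi i j| <= max_offdiag Psi.
Proof. by move=> ij; exact: (le_bigmax_cond _ (j := (i, j))).
Qed.

(** The support of [u - v] lies in the union of the two supports. *)
Lemma nnz_sub (R : realType) (M : nat) (u v : 'cV[R]_M) :
  (nnz (u - v) <= nnz u + nnz v)%N.
Proof.
apply: leq_trans (leq_card_setU _ _); apply/subset_leq_card/subsetP => j.
rewrite !inE !mxE -negb_and; apply: contra => /andP[/eqP-> /eqP->].
by rewrite subr0.
Qed.

Lemma incoherent_sparse_ker0 (R : realType) (M : nat) (Psi : 'M[R]_M)
    (d : 'cV[R]_M) :
  (forall j, Psi j j = 1) -> (nnz d)%:R * max_offdiag Psi < 1 ->
  Psi *m d = 0 -> d = 0.
Proof.
move=> Psi1 small Psid0; set mu := max_offdiag Psi in small.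
pose S := \sum_j `|d j 0|.
have entry_le k : `|d k 0| <= mu * S.
  have /eqP := congr1 (fun A : 'cV[R]_M => A k 0) Psid0.
  rewrite !mxE (bigD1 k) //= Psi1 mul1r addr_eq0 => /eqP->.
  rewrite normrN; apply: le_trans (ler_norm_sum _ _ _) _.
  (* The sum over [j != k] lacks only the term [mu * |d k 0|], which is non-negative, so it can be
     bounded through all of [S]. *)
  rewrite /S [X in _ <= _ * X](bigD1 k) //= mulrDr mulr_sumr; apply: ler_wpDl.
    by rewrite mulr_ge0 ?max_offdiag_ge0.
  apply: ler_sum => j jk; rewrite normrM ler_wpM2r //.
  by apply: le_max_offdiag; rewrite eq_sym.
have S_ge0 : 0 <= S by apply: sumr_ge0.
have S_le : S <= (nnz d)%:R * mu * S.
  (* The right side becomes a sum of [mu * S] over the support of [d], to be compared termwise with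
     [S], whose other terms vanish. *)
  rewrite -mulrA mulr_natl -sumr_const {1}/S.
  rewrite (bigID [in [set j | d j 0 != 0]]) /= [X in _ + X]big1 ?addr0.
    exact: ler_sum.
  by move=> j; rewrite inE negbK => /eqP->; rewrite normr0.
have /eqP : S = 0 by nra.
rewrite psumr_eq0 // => /allP d0; apply/colP => j; rewrite mxE.
by apply/eqP; rewrite -normr_eq0; apply: d0; rewrite mem_index_enum.
Qed.

Theorem mainTheorem4 (R : realType) (n M : nat) (hn : (1 <= n)%N)
    (hM : (1 <= M)%N) (X : 'M[R]_(n, M)) (c0 : R) (hc0 : c0 = 1 \/ c0 = 3)
    (s : nat) (hs : (1 <= s)%N) (alpha : R) (halpha : 1 < alpha)
    (hdiag : forall j : 'I_M, gram X j j = 1)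
    (hoff : max_offdiag (gram X) <= 1 / (alpha * (1 + 2 * c0) * s%:R))
    (Y W : 'cV[R]_n) (theta1 theta2 : 'cV[R]_M)
    (hY1 : Y = X *m theta1 + W) (hY2 : Y = X *m theta2 + W)
    (hs1 : (nnz theta1 <= s)%N) (hs2 : (nnz theta2 <= s)%N) :
  theta1 = theta2.
Proof.
apply/eqP; rewrite -subr_eq0; apply/eqP/(incoherent_sparse_ker0 _ _ (gram X)).
- exact: hdiag.
- have s_gt0 : 0 < s%:R :> R by rewrite ltr0n.
  have nnz_le : (nnz (theta1 - theta2))%:R <= s%:R + s%:R :> R.
    by rewrite -natrD ler_nat (leq_trans (nnz_sub _ _ _ _)) // leq_add.
  (* The factor [1 + 2 * c0] is 3 or 7; the bound 2 matches the support size 2s of a difference. *)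
  have coef_gt2 : 2 < alpha * (1 + 2 * c0) by case: hc0 => ->; lra.
  have mu_ge0 := max_offdiag_ge0 _ _ (gram X).
  apply: le_lt_trans (ler_wpM2r mu_ge0 nnz_le) _.
  move: hoff; rewrite ler_pdivlMr; last by rewrite mulr_gt0 //; lra.
  (* For [mu > 0], [mu * s > 0] turns [coef_gt2] into the strict bound 2 s mu < 1; [mu = 0] is
     immediate. *)
  move: mu_ge0; rewrite le_eqVlt => /predU1P[<-|mu_gt0]; first by rewrite mulr0.
  have := mulr_gt0 mu_gt0 s_gt0; nra.
(* Cancelling [W] puts the difference in the kernel of [X], hence of the Gram matrix. *)
- have XX : X *m theta1 = X *m theta2 by apply: (addIr W); rewrite -hY1.
  by rewrite /gram -scalemxAl -mulmxA mulmxBr XX subrr mulmx0 scaler0.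
Qed.
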